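(* Let $n\geq 1$ be an integer and let $(H,+)$ be an abelian group. Then $S_2(S_n,H)=\operatorname{Hom}(S_n,H)$; that is, a map $f:S_n\to H$ satisfies $f(e)=0$ and $f(xy)+f(y^{-1}x)=2f(x)$ for all $x,y\in S_n$ if and only if $f$ is a group homomorphism from $(S_n,\cdot)$ to $(H,+)$.
   Context: $S_n$ denotes the symmetric group on $n$ elements, written multiplicatively, with neutral element $e$. For a group $(G,\cdot)$ with neutral element $e$ and an abelian group $(H,+)$ with zero element $0$, $S_2(G,H)$ denotes the set of all maps $f:G\to H$ such that $f(e)=0$ and $f(xy)+f(y^{-1}x)=2f(x)$ for all $x,y\in G$. $\operatorname{Hom}(G,H)$ denotes the set of all group homomorphisms from $G$ to $H$. *)

(* Defs.v *)
From mathcomp Require Import all_boot ssralg perm.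
From mathcomp Require Import classical_sets.
Set Implicit Arguments.
Unset Strict Implicit.
Unset Printing Implicit Defensive.

(* The source group is written multiplicatively and the target additively, so
   MathComp's own morphism structures ({multiplicative _ -> _},
   {additive _ -> _}) do not apply to maps G -> H. *)

Definition S2 (G : groupType) (H : zmodType) : set (G -> H) :=
  [set f : G -> H | f 1%g = 0%R /\
     forall x y : G, (f (x * y)%g + f (y^-1 * x)%g = f x *+ 2)%R]%classic.

Definition GrpHom (G : groupType) (H : zmodType) : set (G -> H) :=
  [set f : G -> H | forall x y : G, f (x * y)%g = (f x + f y)%R]%classic.

Arguments S2 G H : clear implicits.
Arguments GrpHom G H : clear implicits.

(* MathComp composes permutations from left to right: (s * t) i = t (s i).
   Passing to the opposite convention amounts to transporting along the group
   isomorphism s |-> s^-1, under which S2 and GrpHom are both stable. *)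

(* Main.v *)
Require Import Defs.
From mathcomp Require Import all_boot ssralg perm.
From mathcomp Require Import classical_sets.
From mathcomp Require Import fingroup.

(** That homomorphisms solve the equation is immediate,
    [H] being abelian.  Let conversely [f] be a solution.  It is odd and
    satisfies [f (x y) + f (y x) = 2 (f x + f y)].

    The first half of the argument shows [2 f = 0].  Applying the last identity
    to the three cyclic rotations of [x y z] expresses [2 f (x y z)] through
    values of [2 f] at products of at most two of the factors
    ([S2_double_triple]).  So [2 f] is controlled by pairs of generators, and
    for transpositions [s], [t] one has [4 f (s t) = 0], while [s t] has order
    dividing 2 or 3; both facts together give [2 f (s t) = 0].  An induction on
    the length of a word in transpositions then kills [2 f] ([S2_Sn_double0]).

    Once [2 f = 0], signs disappear and the equation says that [f (x y)] does
    not change when [x] and [y] are exchanged or when [x] is inverted.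
    Together these moves allow any two factors of a product to be exchanged
    under [f] ([S2_exchange]): [f] factors through the abelianization.  Since
    all transpositions are conjugate, they are interchangeable inside [f], and
    replacing [t t'] by [t t = 1] yields [f (t y) = f t + f y] by induction on
    [y] ([S2_Sn_tperm_additive]), whence additivity in general. *)

Set Implicit Arguments.
Unset Strict Implicit.
Unset Printing Implicit Defensive.

Import GRing.Theory.
Local Open Scope ring_scope.

(** * Solutions on an arbitrary group *)

Lemma GrpHom_S2 (G : groupType) (H : zmodType) (f : G -> H) :
  GrpHom G H f -> S2 G H f.
Proof.
move=> fM; have f1 : f 1%g = 0.
  by apply: (addrI (f 1%g)); rewrite -fM mulg1 addr0.
split=> // x y; have fV : f y^-1%g = - f y.
  by apply: (addrI (f y)); rewrite -fM mulgV f1 subrr.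
by rewrite !fM fV addrA addrK mulr2n.
Qed.

Lemma S2V (G : groupType) (H : zmodType) (f : G -> H) :
  S2 G H f -> forall x, f x^-1%g = - f x.
Proof.
move=> [f1 fE] x; apply: (addrI (f x)).
by have := fE 1%g x; rewrite mul1g mulg1 f1 mul0rn subrr.
Qed.

(** The values [f (y^-1 x)] and [f (x^-1 y)] cancel by oddness when the
    equations for [(x, y)] and [(y, x)] are added. *)
Lemma S2_swap (G : groupType) (H : zmodType) (f : G -> H) :
  S2 G H f -> forall x y, f (x * y)%g + f (y * x)%g = f x *+ 2 + f y *+ 2.
Proof.
move=> Sf x y; case: (Sf) => _ fE; rewrite -(fE x y) -(fE y x) addrACA.
have -> : (x^-1 * y = (y^-1 * x)^-1)%g by rewrite invMg invgK.
by rewrite (S2V Sf) subrr addr0.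
Qed.

Lemma S2_sqr (G : groupType) (H : zmodType) (f : G -> H) :
  S2 G H f -> forall x, f (x * x)%g = f x *+ 2.
Proof. by move=> [f1 fE] x; rewrite -(fE x x) mulVg f1 addr0. Qed.

Lemma S2_cube (G : groupType) (H : zmodType) (f : G -> H) :
  S2 G H f -> forall x, f (x * x * x)%g = f x *+ 3.
Proof.
move=> Sf x; case: (Sf) => _ fE; apply: (addIr (f x)).
have := fE (x * x)%g x; rewrite mulKg (S2_sqr Sf) -mulrnA => ->.
by rewrite -mulrSr.
Qed.

Lemma S2_involution (G : groupType) (H : zmodType) (f : G -> H) :
  S2 G H f -> forall x, (x * x = 1)%g -> f x *+ 2 = 0.
Proof. by move=> Sf x xx; rewrite -(S2_sqr Sf) xx; case: Sf. Qed.

(** Exchanging one factor with the other two, for each of the three cyclic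
    rotations [A], [B], [C] of the product, gives the values of [A + B],
    [B + C] and [C + A], and [2 A + (B + C) = (A + B) + (C + A)]. *)
Lemma S2_double_triple (G : groupType) (H : zmodType) (f : G -> H) :
  S2 G H f -> forall x y z,
  f (x * y * z)%g *+ 2 + (f y *+ 2 + f (z * x)%g *+ 2) =
  f x *+ 2 + f (y * z)%g *+ 2 + (f z *+ 2 + f (x * y)%g *+ 2).
Proof.
move=> Sf x y z; rewrite -!(S2_swap Sf) !mulgA mulr2n.
by rewrite addrACA; congr (_ + _); rewrite addrC.
Qed.

(** Both [s t s] and [t] are involutions, and [2 f (s t)] is the sum of their
    values. *)
Lemma S2_mul_involutions (G : groupType) (H : zmodType) (f : G -> H) :
  S2 G H f -> forall s t, (s * s = 1)%g -> (t * t = 1)%g ->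
  f (s * t)%g *+ 4 = 0.
Proof.
move=> Sf s t ss tt.
have ssts : (s * (s * t) = t)%g by rewrite mulgA ss mul1g.
have := S2_swap Sf (s * t)%g s.
rewrite (S2_involution Sf ss) addr0 ssts => e.
rewrite (mulrnA _ 2 2) -e mulrnDl (S2_involution Sf tt) addr0.
apply: (S2_involution Sf); rewrite -!mulgA (mulgA s s) ss mul1g.
by rewrite (mulgA t t) tt mul1g.
Qed.

(** * Solutions with values of order two *)

Lemma S2_order2_mulC (G : groupType) (H : zmodType) (f : G -> H) :
  S2 G H f -> (forall x, f x *+ 2 = 0) ->
  forall x y, f (x * y)%g = f (y * x)%g.
Proof.
move=> Sf f2 x y; apply: (addIr (f (y * x)%g)).
by rewrite (S2_swap Sf) !f2 addr0 -mulr2n f2.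
Qed.

Lemma S2_order2_invl (G : groupType) (H : zmodType) (f : G -> H) :
  S2 G H f -> (forall x, f x *+ 2 = 0) ->
  forall x y, f (x^-1 * y)%g = f (x * y)%g.
Proof.
move=> Sf f2 x y; case: (Sf) => _ fE.
rewrite (S2_order2_mulC Sf f2 x); apply/esym/(addIr (f (x^-1 * y)%g)).
by rewrite fE f2 -mulr2n f2.
Qed.

(** Inverting [u v] as a block turns it into [v^-1 u^-1]; inverting its two
    factors separately, after rotating them to the front, gives [v u]. *)
Lemma S2_exchange (G : groupType) (H : zmodType) (f : G -> H) :
  S2 G H f -> (forall x, f x *+ 2 = 0) ->
  forall u v w, f (u * (v * w))%g = f (v * (u * w))%g.
Proof.
move=> Sf f2 u v w.
have fC := S2_order2_mulC Sf f2; have fV := S2_order2_invl Sf f2.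
have -> : f (u * (v * w))%g = f (v^-1 * (u^-1 * w))%g.
  by rewrite mulgA -(fV (u * v)%g) invMg mulgA.
by rewrite fV (fC v (u^-1 * w)%g) -mulgA fV mulgA (fC (u * w)%g).
Qed.

Lemma S2_conj (G : groupType) (H : zmodType) (f : G -> H) :
  S2 G H f -> (forall x, f x *+ 2 = 0) ->
  forall t u w, f ((t ^ u)%g * w)%g = f (t * w)%g.
Proof.
move=> Sf f2 t u w.
by rewrite /conjg -!mulgA (S2_exchange Sf f2) mulKg.
Qed.

(** * Transpositions *)

Lemma tperm_ind (T : finType) (P : {perm T} -> Prop) :
  P 1%g ->
  (forall x y s, x != y -> P s -> P (tperm x y * s)%g) ->
  forall s, P s.
Proof.
move=> P1 PM s; have [ts -> {s}] := prod_tpermP s.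
elim: ts => [|t ts IH] /=; first by rewrite big_nil.
by case/andP=> nt /IH Pts; rewrite big_cons; apply: PM.
Qed.

Lemma tperm_conjugate (T : finType) (a b c d : T) :
  a != b -> c != d -> exists u, tperm c d = (tperm a b ^ u)%g.
Proof.
move=> ab cd.
(* The first factor sends [a] to [c]; the second fixes [c] and sends the image
   of [b] to [d]. *)
exists (tperm a c * tperm (tperm a c b) d)%g.
have nc : tperm a c b != c by rewrite -{2}(tpermL a c) (inj_eq perm_inj) eq_sym.
by rewrite tpermJ !permM tpermL tpermL tpermD // eq_sym.
Qed.

(** Disjoint transpositions commute; if they share a point, each conjugates
    the other to the same third transposition, which is the braid relation. *)
Lemma tperm_mul_order (T : finType) (a b c d : T) :
  a != b -> c != d ->
  let p := (tperm a b * tperm c d)%g in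
  (p * p = 1)%g \/ (p * p * p = 1)%g.
Proof.
have braid (x y z : T) : x != y -> x != z -> y != z ->
    let p := (tperm x y * tperm x z)%g in (p * p * p = 1)%g.
  move=> xy xz yz /=.
  have : (tperm x y ^ tperm x z = tperm x z ^ tperm x y)%g.
    rewrite !tpermJ !tpermL (tpermD xy) 1?eq_sym // (tpermD xz) //.
    by rewrite tpermC.
  rewrite /conjg !tpermV -!mulgA => ->.
  by rewrite (mulgA (tperm x y) (tperm x y)) tperm2 mul1g
             (mulgA (tperm x z)) tperm2 mul1g tperm2.
move=> ab cd /=.
have ba : b != a by rewrite eq_sym.
have dc : d != c by rewrite eq_sym.
have [e|ac] := eqVneq a c; first subst c.
  have [<-|bd] := eqVneq b d; first by left; rewrite tperm2 mulg1.
  by right; apply: braid.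
have [e|ad] := eqVneq a d; first subst d.
  have [<-|bc] := eqVneq b c; first by left; rewrite (tpermC b) tperm2 mulg1.
  by right; rewrite (tpermC c); apply: braid.
rewrite (tpermC a b); have [e|bc] := eqVneq b c; first subst c.
  by right; apply: braid.
have [e|bd] := eqVneq b d; first subst d.
  by right; rewrite (tpermC c); apply: braid.
left; have : (tperm c d ^ tperm b a = tperm c d)%g by rewrite tpermJ !tpermD.
move/conjg_fixP/commgP => com.
by rewrite -mulgA -com (mulgA (tperm c d)) tperm2 mul1g tperm2.
Qed.

(** * Solutions on the symmetric group *)

Lemma S2_tperm_mul_double0 (n : nat) (H : zmodType) (f : 'S_n -> H) :
  S2 'S_n H f -> forall a b c d, a != b -> c != d ->
  f (tperm a b * tperm c d)%g *+ 2 = 0.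
Proof.
move=> Sf a b c d ab cd.
have [p2|p3] := tperm_mul_order ab cd; first exact: (S2_involution Sf p2).
have f4 := S2_mul_involutions Sf (tperm2 a b) (tperm2 c d).
have f3 : f (tperm a b * tperm c d)%g *+ 3 = 0.
  by rewrite -(S2_cube Sf) p3; case: Sf.
(* As 3 and 4 are coprime, the value itself vanishes. *)
by move: f4; rewrite mulrSr f3 add0r => ->; rewrite mul0rn.
Qed.

(** By induction on [s]: when [s = t' s'], the formula for [2 f (t t' s')]
    involves, apart from [2 f s] itself, only [t t'], single transpositions, and
    [s'] with at most one transposition on its right; the latter is brought to
    the left, where the induction hypothesis applies, by [S2_swap]. *)
Lemma S2_Sn_double_tpermM (n : nat) (H : zmodType) (f : 'S_n -> H) :
  S2 'S_n H f -> forall s a b, a != b ->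
  f (tperm a b * s)%g *+ 2 = f s *+ 2.
Proof.
move=> Sf; have ft a b : f (tperm a b) *+ 2 = 0.
  exact: (S2_involution Sf (tperm2 a b)).
elim/tperm_ind=> [|c d s cd IH] a b ab.
  by rewrite mulg1 ft; case: Sf => ->; rewrite mul0rn.
have fst : f (s * tperm a b)%g *+ 2 = f s *+ 2.
  apply: (addrI (f (tperm a b * s)%g *+ 2)).
  by rewrite -mulrnDl (S2_swap Sf) ft add0r (IH _ _ ab) mulr2n.
have := S2_double_triple Sf (tperm a b) (tperm c d) s.
rewrite !ft (S2_tperm_mul_double0 Sf ab cd) fst !add0r addr0 mulgA.
exact: addIr.
Qed.

Lemma S2_Sn_double0 (n : nat) (H : zmodType) (f : 'S_n -> H) :
  S2 'S_n H f -> forall s, f s *+ 2 = 0.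
Proof.
move=> Sf; elim/tperm_ind=> [|a b s ab IH].
  by case: Sf => ->; rewrite mul0rn.
by rewrite (S2_Sn_double_tpermM Sf).
Qed.

(** By induction on [s]: when [s = t' s'], exchanging and conjugating turn
    [t t' s'] into [t t s' = s'] and [t' s'] into [t s'], so that the two sides
    are [f s'] and [2 f t + f s']. *)
Lemma S2_Sn_tperm_additive (n : nat) (H : zmodType) (f : 'S_n -> H) :
  S2 'S_n H f -> forall s a b, a != b ->
  f (tperm a b * s)%g = f (tperm a b) + f s.
Proof.
move=> Sf; have f2 := S2_Sn_double0 Sf.
elim/tperm_ind=> [|c d s cd IH] a b ab.
  by rewrite mulg1; case: Sf => ->; rewrite addr0.
have ft w : f (tperm c d * w)%g = f (tperm a b * w)%g.
  by have [u ->] := tperm_conjugate ab cd; rewrite (S2_conj Sf f2).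
rewrite (S2_exchange Sf f2) !ft mulgA tperm2 mul1g IH //.
by rewrite addrA -mulr2n f2 add0r.
Qed.

Theorem theorem3p1 (n : nat) (hn : (1 <= n)%N) (H : zmodType) :
  S2 'S_n H = GrpHom 'S_n H.
Proof.
apply/seteqP; split=> f; last exact: GrpHom_S2.
move=> Sf; have ft := S2_Sn_tperm_additive Sf.
elim/tperm_ind=> [|a b s ab IH] y.
  by rewrite mul1g; case: Sf => ->; rewrite add0r.
by rewrite -mulgA !ft // IH addrA.
Qed.
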